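(* The groups $\mathrm{PL}^+[0,1]$ and $\mathrm{H}(\mathbf{R})$ lie in the class (LEJI). That is, if $\Gamma$ is either of the groups $\mathrm{PL}^+[0,1]$ or $\mathrm{H}(\mathbf{R})$, then for every finitely generated subgroup $H\leq \Gamma$ and every surjective homomorphism $\phi:H\to J$ onto a just infinite group $J$, the group $J$ is virtually abelian.
   Context: A group is just infinite if every nontrivial normal subgroup is of finite index. A group is elementarily just infinite if every just infinite quotient of it is virtually abelian (i.e. has an abelian subgroup of finite index). A group is locally elementarily just infinite, or in the class (LEJI), if every finitely generated subgroup of it is elementarily just infinite. $\mathrm{PL}^+[0,1]$ is the group, under composition, of piecewise linear orientation preserving homeomorphisms of $[0,1]$ (with finitely many breakpoints). $\mathrm{H}(\mathbf{R})$ is Monod's group of piecewise projective homeomorphisms of the real line: the group, under composition, of all orientation preserving homeomorphisms $f$ of $\mathbf{R}$ for which there is a partition of $\mathbf{R}$ into finitely many intervals such that on each of them $f$ agrees with a fractional linear transformation $t\mapsto \frac{at+b}{ct+d}$, where $a,b,c,d\in\mathbf{R}$ and $ad-bc=1$. Equivalently, it is the stabilizer of $\infty$ in the group of homeomorphisms of $\mathbf{R}\cup\{\infty\}$ that are piecewise in $\mathrm{PSL}_2(\mathbf{R})$ with finitely many pieces. *)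

(* Defs.v *)
From HB Require Import structures.
From mathcomp Require Import all_boot all_order all_algebra.
From mathcomp Require Import all_classical all_reals topology normedtype.
From mathcomp Require Import ring.

Set Implicit Arguments.
Unset Strict Implicit.
Unset Printing Implicit Defensive.

Import Order.TTheory GRing.Theory Num.Theory.
Import numFieldNormedType.Exports.

Local Open Scope classical_set_scope.

Section SubgroupType.
Variables (G : groupType) (H : groupClosed G).

Definition subgroup : Type := {x : G | x \in H}.

HB.instance Definition _ := SubChoice.on subgroup.

Fact subgroup_closed : group_closed [in H].
Proof. by split=> [|x y xH yH]; [exact: gpred1 | exact: gpredF]. Qed.

HB.instance Definition _ :=
  SubChoice_isSubGroup.Build G [in H] subgroup subgroup_closed.

End SubgroupType.

Section GroupProperties.
Local Open Scope group_scope.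
Implicit Types G J : groupType.

Definition finitely_generated G :=
  exists s : seq G,
    forall K : groupClosed G, {subset s <= K} -> forall x, x \in K.

Definition left_coset G (N : groupClosed G) (g : G) : set G :=
  [set g * h | h in [set h | h \in N]].

Definition finite_index G (N : groupClosed G) := finite_set (range (left_coset N)).

Definition normal_subgroup G (N : groupClosed G) :=
  forall x y : G, x \in N -> x ^ y \in N.

(* Finite groups are not excluded here; they are virtually abelian anyway. *)
Definition just_infinite G :=
  forall N : groupClosed G, normal_subgroup N ->
    (exists2 x, x \in N & x != 1) -> finite_index N.

Definition virtually_abelian G :=
  exists2 A : groupClosed G, finite_index A & {in A &, forall x y, commute x y}.

Definition elementarily_just_infinite G :=
  forall (J : groupType) (phi : {multiplicative G -> J}),
    (forall y, exists x, phi x = y) -> just_infinite J -> virtually_abelian J.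

Definition LEJI G :=
  forall H : groupClosed G, finitely_generated (subgroup H) ->
    elementarily_just_infinite (subgroup H).

End GroupProperties.

Section Homeomorphisms.
Variable T : topologicalType.

Record homeo := Homeo {
  homeo_fun :> T -> T;
  homeo_inv : T -> T;
  homeoK : cancel homeo_fun homeo_inv;
  homeo_invK : cancel homeo_inv homeo_fun;
  homeo_continuous : continuous homeo_fun;
  homeo_inv_continuous : continuous homeo_inv }.

HB.instance Definition _ := gen_eqMixin homeo.
HB.instance Definition _ := gen_choiceMixin homeo.

Lemma homeoP (f g : homeo) : f =1 g -> f = g.
Proof.
case: f g => [f f' fK f'K cf cf'] [g g' gK g'K cg cg'] /= fg.
have {}fg : f = g by apply/funext.
rewrite -{}fg in gK g'K cg *.
have e : f' = g' by apply/funext=> x; rewrite -[x in LHS]g'K fK.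
rewrite -{}e in gK g'K cg' *.
by congr Homeo; exact: Prop_irrelevance.
Qed.

Definition homeo1 : homeo :=
  @Homeo id id (fun=> erefl) (fun=> erefl) (fun=> cvg_id) (fun=> cvg_id).

Definition homeoV (f : homeo) : homeo :=
  Homeo (@homeo_invK f) (@homeoK f)
    (@homeo_inv_continuous f) (@homeo_continuous f).

Definition homeoM (f g : homeo) : homeo :=
  @Homeo (f \o g) (homeo_inv g \o homeo_inv f)
    (can_comp (@homeoK f) (@homeoK g))
    (can_comp (@homeo_invK g) (@homeo_invK f))
    (fun x => continuous_comp (@homeo_continuous g x) (@homeo_continuous f (g x)))
    (fun x => continuous_comp (@homeo_inv_continuous f x)
       (@homeo_inv_continuous g (homeo_inv f x))).

Fact homeoMA : associative homeoM. Proof. by move=> f g h; exact: homeoP. Qed.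
Fact homeo1M : left_id homeo1 homeoM. Proof. by move=> f; exact: homeoP. Qed.
Fact homeoM1 : right_id homeo1 homeoM. Proof. by move=> f; exact: homeoP. Qed.
Fact homeoVM : left_inverse homeo1 homeoV homeoM.
Proof. by move=> f; apply: homeoP => x /=; rewrite homeoK. Qed.
Fact homeoMV : right_inverse homeo1 homeoV homeoM.
Proof. by move=> f; apply: homeoP => x /=; rewrite homeo_invK. Qed.

HB.instance Definition _ :=
  isGroup.Build homeo homeoMA homeo1M homeoM1 homeoVM homeoMV.

End Homeomorphisms.

Local Open Scope ring_scope.

Section Piecewise.
Variable R : realType.
Implicit Types (A B C D : set R) (P Q : set R -> Prop).

Definition piecewise D P :=
  exists Pi : set (set R),
    [/\ finite_set Pi, partition Pi id D &
        forall A, Pi A -> is_interval A /\ P A].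

Lemma piecewise_sub D P Q :
  (forall A, A `<=` D -> P A -> Q A) -> piecewise D P -> piecewise D Q.
Proof.
move=> PQ [Pi [fPi pPi PiP]]; exists Pi; split=> // A PiA.
have [iA PA] := PiP A PiA; split=> //; apply: PQ PA => x Ax.
by have [<- _ _] := pPi; exists A.
Qed.

Lemma piecewise1 D P : D !=set0 -> is_interval D -> P D -> piecewise D P.
Proof.
move=> D0 iD PD; exists [set D]; split; [exact: finite_set1| |by move=> _ ->].
split; [by rewrite /cover bigcup_set1|by move=> ? ? -> ->|by move=> _ ->].
Qed.

Lemma piecewiseI D P Q : piecewise D P -> piecewise D Q ->
  piecewise D (fun C => exists A B, [/\ P A, Q B, C `<=` A & C `<=` B]).
Proof.
move=> [Pi [fPi [cPi tPi nPi] PiP]] [Qi [fQi [cQi tQi nQi] QiP]].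
exists ([set C | C !=set0] `&` [set A `&` B | A in Pi & B in Qi]); split.
- by apply: sub_finite_set (finite_image2 setI fPi fQi) => C [].
- split; last by move=> C [].
  + apply/seteqP; split=> [x [_ [_ [A PA [B QB <-]]] [Ax Bx]]|x Dx].
      by rewrite -cPi; exists A.
    have [A PA Ax] : cover Pi id x by rewrite cPi.
    have [B QB Bx] : cover Qi id x by rewrite cQi.
    exists (A `&` B) => //; split; first by exists x.
    by exists A => //; exists B.
  + move=> _ _ [_ [A PA [B QB <-]]] [_ [A' PA' [B' QB' <-]]] [x [[Ax Bx] [Ax' Bx']]].
    by congr (_ `&` _); [apply: tPi|apply: tQi] => //; exists x.
- move=> _ [_ [A PA [B QB <-]]]; split; last first.
    exists A, B; split; [by case: (PiP A PA)|by case: (QiP B QB)| |].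
      exact: subIsetl.
    exact: subIsetr.
  move=> x y [Ax Bx] [Ay By] z xzy; split.
    by have [/(_ x y Ax Ay z xzy)] := PiP A PA.
  by have [/(_ x y Bx By z xzy)] := QiP B QB.
Qed.

Lemma piecewise_pull (X : Type) (v : X -> R) (h : X -> X) D P :
  range v = D -> is_interval D -> injective v ->
  (forall x y, v x <= v y -> v (h x) <= v (h y)) ->
  piecewise D P ->
  piecewise D (fun C => exists2 B, P B & forall x, C (v x) -> B (v (h x))).
Proof.
move=> rv iD vI hh [Pi [fPi [cPi tPi nPi] PiP]].
pose g B := v @` [set x | B (v (h x))].
have gE B x : g B (v x) -> B (v (h x)) by move=> [y By /vI <-].
exists ([set C | C !=set0] `&` [set g B | B in Pi]); split.
- by apply: sub_finite_set (finite_image g fPi) => C [].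
- split; last by move=> C [].
  + apply/seteqP; split=> [x [_ [_ [B PB <-]] [y _ <-]]|x].
      by rewrite -rv; exists y.
    rewrite -rv => -[y _ <-].
    have [B PB By] : cover Pi id (v (h y)) by rewrite cPi -rv; exists (h y).
    exists (g B); last by exists y.
    by split; [exists (v y); exists y|exists B].
  + move=> _ _ [_ [B PB <-]] [_ [B' PB' <-]] [_ [[y By <-] /gE By']].
    by congr g; apply: tPi => //; exists (v (h y)).
- move=> _ [_ [B PB <-]]; have [iB ?] := PiP B PB.
  split; last by exists B => // x /gE.
  move=> _ _ [x Bx <-] [y By <-] z /andP[xz zy].
  have : D z by apply: (iD (v x) (v y)); rewrite -?rv ?xz//; exact: imageT.
  rewrite -rv => -[t _ tz]; rewrite -tz in xz zy *.
  by exists t => //; apply: (iB _ _ Bx By); rewrite !hh.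
Qed.

End Piecewise.

Section PLGroup.
Variable R : realType.

Local Notation I01 := (`[0, 1]%classic : set R).

Definition affine_on (f : I01 -> I01) (A : set R) :=
  exists a b : R, forall x : I01, A (\val x) -> \val (f x) = a * \val x + b.

Definition is_PLplus01 (f : homeo I01) :=
  {mono f : x y / \val x < \val y} /\ piecewise I01 (affine_on f).

Definition PLplus01_pred : {pred homeo I01} := [pred f | `[< is_PLplus01 f >]].

Let val_range : range (\val : I01 -> R) = I01.
Proof.
apply/seteqP; split=> [_ [x _ <-]|x Ix]; first exact: set_valP.
by exists (SigSub (mem_set Ix)).
Qed.

Let I01_interval : is_interval I01. Proof. exact: interval_is_interval. Qed.

Let I01_neq0 : I01 !=set0.
Proof. by exists 0; rewrite /= in_itv /= lexx ler01. Qed.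

Let mono_le (f : homeo I01) : {mono f : x y / \val x < \val y} ->
  forall x y, \val x <= \val y -> \val (f x) <= \val (f y).
Proof. by move=> fm x y; rewrite !leNgt fm. Qed.

Fact PLplus01_1 : (1%g : homeo I01) \in PLplus01_pred.
Proof.
apply/asboolP; split=> //; apply: piecewise1 => //.
by exists 1, 0 => x _; rewrite mul1r addr0.
Qed.

Fact PLplus01_M : mulg_closed PLplus01_pred.
Proof.
move=> f g /asboolP[fm fp] /asboolP[gm gp]; apply/asboolP.
split=> [x y /=|]; first by rewrite fm gm.
have := piecewiseI gp
  (piecewise_pull val_range I01_interval val_inj (mono_le gm) fp).
apply: piecewise_sub => C _ [A [B [[a [b gE]] [B' [c [d fE]] BB'] CA CB]]].
exists (c * a), (c * b + d) => x Cx /=.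
rewrite fE; last exact/BB'/CB.
by rewrite gE ?mulrDr ?mulrA ?addrA//; exact: CA.
Qed.

Fact PLplus01_V : invg_closed PLplus01_pred.
Proof.
move=> f /asboolP[fm fp]; apply/asboolP.
have fVm : {mono (f^-1)%g : x y / \val x < \val y}.
  by move=> x y; rewrite -fm /= !homeo_invK.
split=> //.
have := piecewise_pull val_range I01_interval val_inj (mono_le fVm) fp.
apply: piecewise_sub => C CD [B [a [b fE]] BC].
have fVE x : C (\val x) -> \val x = a * \val ((f^-1)%g x) + b.
  by move=> Cx; rewrite -fE ?homeo_invK//; exact: BC.
have [a0|a0] := eqVneq a 0; last first.
  by exists a^-1, (- (b / a)) => x Cx; rewrite [in RHS]fVE//; field.
(* zero slope: the piece has at most one point *)
have [[x0 Cx0]|C0] := pselect (exists x : I01, C (\val x)).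
  exists 0, (\val ((f^-1)%g x0)) => x Cx; rewrite mul0r add0r.
  by congr (\val ((f^-1)%g _)); apply: val_inj; rewrite (fVE x)// (fVE x0)// a0 !mul0r.
by exists 0, 0 => x Cx; case: C0; exists x.
Qed.

HB.instance Definition _ := isMulClosed.Build (homeo I01) PLplus01_pred PLplus01_M.
HB.instance Definition _ := isMul1Closed.Build (homeo I01) PLplus01_pred PLplus01_1.
HB.instance Definition _ := isInvClosed.Build (homeo I01) PLplus01_pred PLplus01_V.

Definition PLplus01 : groupType := subgroup PLplus01_pred.

End PLGroup.

Section MonodGroup.
Variable R : realType.

(* As [x / 0 = 0], the nonvanishing of the denominator is stated explicitly. *)
Definition projective_on (f : R -> R) (A : set R) :=
  exists a b c d : R, a * d - b * c = 1 /\
    forall t, A t -> c * t + d != 0 /\ f t = (a * t + b) / (c * t + d).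

Definition is_MonodH (f : homeo R) :=
  {mono f : x y / x < y} /\ piecewise [set: R] (projective_on f).

Definition MonodH_pred : {pred homeo R} := [pred f | `[< is_MonodH f >]].

Let setT_interval : is_interval [set: R]. Proof. by []. Qed.

Let id_range : range (@id R) = [set: R]. Proof. exact: image_id. Qed.

Let mono_le (f : homeo R) : {mono f : x y / x < y} ->
  forall x y, x <= y -> f x <= f y.
Proof. by move=> fm x y; rewrite !leNgt fm. Qed.

Fact MonodH_1 : (1%g : homeo R) \in MonodH_pred.
Proof.
apply/asboolP; split=> //; apply: piecewise1 => //; first by exists 0.
exists 1, 0, 0, 1; split=> [|t _]; first by ring.
by rewrite mul0r add0r oner_neq0 divr1 mul1r addr0.
Qed.

Fact MonodH_M : mulg_closed MonodH_pred.
Proof.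
move=> f g /asboolP[fm fp] /asboolP[gm gp]; apply/asboolP.
split=> [x y /=|]; first by rewrite fm gm.
have := piecewiseI gp
  (piecewise_pull id_range setT_interval (@inj_id R) (mono_le gm) fp).
apply: piecewise_sub => C _ [A [B [[a [b [c [d [det gE]]]]]
  [B' [a' [b' [c' [d' [det' fE]]]]] BB'] CA CB]]].
exists (a' * a + b' * c), (a' * b + b' * d), (c' * a + d' * c), (c' * b + d' * d).
split=> [|t Ct].
  have -> : 1 = (a' * d' - b' * c') * (a * d - b * c) :> R by rewrite det det' mulr1.
  by ring.
have [gd gt] := gE t (CA t Ct).
have [fd ft] := fE (g t) (BB' t (CB t Ct)).
have e : (c' * a + d' * c) * t + (c' * b + d' * d) =
         (c' * g t + d') * (c * t + d) by rewrite gt; field.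
have d0 : (c' * a + d' * c) * t + (c' * b + d' * d) != 0 by rewrite e mulf_neq0.
split=> //; rewrite /= ft e gt in fd *; field.
rewrite gd /=; move: d0; apply: contra_neq => <-; ring.
Qed.

Fact MonodH_V : invg_closed MonodH_pred.
Proof.
move=> f /asboolP[fm fp]; apply/asboolP.
have fVm : {mono (f^-1)%g : x y / x < y}.
  by move=> x y; rewrite -fm /= !homeo_invK.
split=> //.
have := piecewise_pull id_range setT_interval (@inj_id R) (mono_le fVm) fp.
apply: piecewise_sub => C _ [B [a [b [c [d [det fE]]]]] BC].
exists d, (- b), (- c), a; split=> [|t Ct].
  by rewrite -det; ring.
have [] := fE _ (BC t Ct); set s := (f^-1)%g t => sd.
have -> : f s = t by rewrite /s /= homeo_invK.
move=> tE.
have e : (- c * t + a) * (c * s + d) = 1 by rewrite -det tE; field.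
have t0 : - c * t + a != 0.
  by apply: contra_eq_neq e => ->; rewrite mul0r eq_sym oner_neq0.
split=> //; apply: (mulIf t0); rewrite divfK//; apply: (mulIf sd).
rewrite -mulrA e mulr1 tE.
have -> : (d * ((a * s + b) / (c * s + d)) + - b) * (c * s + d) =
          s * (a * d - b * c) by field.
by rewrite det mulr1.
Qed.

HB.instance Definition _ := isMulClosed.Build (homeo R) MonodH_pred MonodH_M.
HB.instance Definition _ := isMul1Closed.Build (homeo R) MonodH_pred MonodH_1.
HB.instance Definition _ := isInvClosed.Build (homeo R) MonodH_pred MonodH_V.

Definition MonodH : groupType := subgroup MonodH_pred.

End MonodGroup.

(* Main.v *)
(* Let H be a finitely generated group of increasing piecewise projective
   bijections of R; PL^+[0,1] is included since an affine map of positive slope is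
   projective and elements extend by the identity outside [0,1].  The points moved
   by H lie in the convex hulls of finitely many orbits.  Near each end of such a
   hull, H acts by affine maps in a suitable coordinate, so that commutators have
   translation germs there, and commutators of those have trivial germs.  A finite
   set of elements with trivial germs at both ends of a hull has supports, within
   this hull, between two points u < v; some h in H moves u beyond v, and then the
   elements of the set commute on the hull with their conjugates by h.
   This gives a chain H > K1 > K2 > ... > 1 of normal subgroups such that any
   finite subset F of one term has a conjugate F^h with [F, F^h] in the next term.
   Let J be a just infinite quotient of H, and suppose that the image of a term has
   finite index in J.  That image is finitely generated, so if the image of the next
   term is trivial it is abelian, hence J is virtually abelian; otherwise the image
   of the next term also has finite index.  At the end of the chain J is finite. *)

Require Import Defs.
From HB Require Import structures.
From mathcomp Require Import all_boot all_order all_algebra.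
From mathcomp Require Import all_classical all_reals topology normedtype.
From mathcomp Require Import reals.
From mathcomp Require Import ring lra.

Set Implicit Arguments.
Unset Strict Implicit.
Unset Printing Implicit Defensive.

Import Order.TTheory GRing.Theory Num.Theory.
Import numFieldNormedType.Exports.

Local Open Scope classical_set_scope.

(** * Quotients of chains of normal subgroups *)

Section Subgroups.
Local Open Scope group_scope.
Variable G : groupType.
Implicit Types (P Q : set G) (S T : seq G).

Definition is_subgroup P :=
  [/\ P 1, forall x y, P x -> P y -> P (x * y) & forall x, P x -> P x^-1].

(** Classical decidability of [P] gives the bundled subgroup over which generation and finite index
    are defined. *)
Lemma groupClosed_of P : is_subgroup P ->
  exists N : groupClosed G, forall x, x \in N <-> P x.
Proof.
move=> [P1 PM PV]; pose p : {pred G} := [pred x | `[< P x >]].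
have pM : mulg_closed p by move=> x y /asboolP ? /asboolP ?; exact/asboolP/PM.
have p1 : 1 \in p by exact/asboolP.
have pV : invg_closed p by move=> x /asboolP ?; exact/asboolP/PV.
pose N : groupClosed G := HB.pack p (isMulClosed.Build G p pM)
  (isMul1Closed.Build G p p1) (isInvClosed.Build G p pV).
by exists N => x; split=> /asboolP.
Qed.

(** Finite index without counting cosets: [T] may meet a coset several times. *)
Definition has_transversal P := exists T, forall y, exists2 t, t \in T & P (t^-1 * y).

Lemma finite_indexP (N : groupClosed G) :
  finite_index N <-> has_transversal [set x | x \in N].
Proof.
have cosetP x y : left_coset N x = left_coset N y <-> x^-1 * y \in N.
  split=> [e|xyN].
    have : left_coset N y y by exists 1; rewrite ?mulg1//; exact: gpred1.
    by rewrite -e => -[h hN <-]; rewrite mulKg.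
  rewrite /left_coset; apply/seteqP; split=> _ [h hN <-].
    exists ((x^-1 * y)^-1 * h); first by rewrite /= gpredMr ?gpredV.
    by rewrite invgM invgK -!mulgA mulVKg.
  exists (x^-1 * y * h); first by rewrite /= gpredMr.
  by rewrite -!mulgA mulVKg.
split=> [|[T TP]].
  move=> /finite_seqP[s sE].
  have /choice[r rE] : forall C, exists x, C \in s -> left_coset N x = C.
    move=> C; have [Cs|] := boolP (C \in s); last by exists 1.
    have : range (left_coset N) C by rewrite sE.
    by move=> [x _ <-]; exists x.
  exists (map r s) => y.
  have ys : left_coset N y \in s.
    by have : range (left_coset N) (left_coset N y) by [exists y]; rewrite sE.
  by exists (r (left_coset N y)); [exact: map_f|exact/cosetP/rE].
apply: (@sub_finite_set _ _ [set` map (left_coset N) T]); last exact: finite_seq.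
move=> _ [y _ <-] /=; have [t tT ty] := TP y.
by have /cosetP <- : t^-1 * y \in N by []; exact: map_f.
Qed.

Definition is_normal P := is_subgroup P /\ forall x y, P x -> P (x ^ y).

Lemma is_normal_setI P Q : is_normal P -> is_normal Q -> is_normal (P `&` Q).
Proof.
move=> [[P1 PM PV] nP] [[Q1 QM QV] nQ]; split; first split=> //.
- by move=> x y [? ?] [? ?]; split; [exact: PM|exact: QM].
- by move=> x [? ?]; split; [exact: PV|exact: QV].
- by move=> x y [? ?]; split; [exact: nP|exact: nQ].
Qed.

Lemma is_normal_bigcap (I : Type) (D : set I) (P : I -> set G) :
  (forall i, D i -> is_normal (P i)) -> is_normal (\bigcap_(i in D) P i).
Proof.
move=> nP; split; first split.
- by move=> i /nP[[]].
- by move=> x y Px Py i Di; have [[_ PM _] _] := nP i Di; apply: PM; [exact: Px|exact: Py].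
- by move=> x Px i Di; have [[_ _ PV] _] := nP i Di; exact/PV/Px.
- by move=> x y Px i Di; have [_] := nP i Di; apply; exact: Px.
Qed.

(* Schreier's lemma *)
Lemma finitely_generated_subgroup P : finitely_generated G -> is_subgroup P ->
  has_transversal P ->
  exists2 F : seq G, (forall x, x \in F -> P x) &
    forall Q, is_subgroup Q -> (forall x, x \in F -> Q x) -> P `<=` Q.
Proof.
move=> [s sgen] [P1 PM PV] [T0 T0P].
pose T := 1 :: T0; pose S := s ++ [seq g^-1 | g <- s].
(* Besides the Schreier generators, [F] contains the elements of [T] in [P], as the coset of [P]
   itself may be represented by some [t] other than 1. *)
pose F := [seq x <- T ++ [seq t'^-1 * y | t' <- T, y <- [seq g * t | g <- S, t <- T]] | `[< P x >]].
exists F => [x|Q [Q1 QM QV] FQ]; first by rewrite mem_filter => /andP[/asboolP].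
(* [W] contains 1 and is stable under left multiplication by [S], hence is all of [G]; for [x] in
   [P] this puts [x] in [t * Q] with [t] in both [T] and [P]. *)
pose W y := exists t, [/\ t \in T, Q (t^-1 * y) & P (t^-1 * y)].
have WS g y : g \in S -> W y -> W (g * y).
  move=> gS [t [tT Qty Pty]]; have [t' t'T0 Pt'] := T0P (g * t).
  have t'T : t' \in T by rewrite inE t'T0 orbT.
  have Q't : Q (t'^-1 * (g * t)).
    apply: FQ; rewrite mem_filter; apply/andP; split.
      exact/asboolP.
    rewrite mem_cat; apply/orP; right.
    apply: (allpairs_f (fun a b => a^-1 * b)) => //.
    exact: (allpairs_f (fun a b => a * b)).
  exists t'; have -> : t'^-1 * (g * y) = t'^-1 * (g * t) * (t^-1 * y).
    by rewrite -!mulgA mulVKg.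
  by split => //; [exact: QM|exact: PM].
have [N NE] : exists N : groupClosed G, forall x, x \in N <->
    forall y, W y -> W (x * y) /\ W (x^-1 * y).
  apply: groupClosed_of; split.
  - by move=> y Wy; rewrite invg1 mul1g.
  - move=> a b Wa Wb y Wy; rewrite invgM -!mulgA; split.
      by apply Wa; apply Wb.
    by apply Wb; apply Wa.
  - by move=> a Wa y Wy; rewrite invgK; split; apply Wa.
move=> x Px.
have : x \in N.
  apply: sgen => g gs; apply/NE => y Wy; split; apply: WS => //.
    by rewrite mem_cat gs.
  by rewrite mem_cat map_f ?orbT.
move=> /NE/(_ 1)[].
  by exists 1; rewrite inE eqxx invg1 mulg1.
move=> [t [tT Qt Pt]] _; rewrite mulg1 in Qt Pt.
rewrite -[x](mulVKg t); apply: QM => //; apply: FQ.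
rewrite mem_filter mem_cat tT andbT; apply/asboolP.
have -> : t = x * (t^-1 * x)^-1 by rewrite invgM invgK mulVKg.
by apply: PM => //; exact: PV.
Qed.

Lemma virtually_abelian_of P : is_subgroup P -> has_transversal P ->
  (forall x y, P x -> P y -> commute x y) -> virtually_abelian G.
Proof.
move=> gP [T TP] cP; have [N NE] := groupClosed_of gP.
exists N => [|x y /NE Px /NE Py]; last exact: cP.
apply/finite_indexP; exists T => y; have [t tT ?] := TP y.
by exists t => //=; exact/NE.
Qed.

Lemma just_infinite_transversal P : just_infinite G -> is_normal P ->
  (exists2 x, P x & x != 1) -> has_transversal P.
Proof.
move=> jG [gP nP] [x Px x1]; have [N NE] := groupClosed_of gP.
have /finite_indexP[T TP] : finite_index N.
  apply: jG => [y z /NE Py|]; first exact/NE/nP.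
  by exists x => //; exact/NE.
by exists T => y; have [t tT /NE] := TP y; exists t.
Qed.

End Subgroups.

(** * Just infinite quotients *)

Section JustInfiniteQuotient.
Local Open Scope group_scope.
Variables (H J : groupType) (phi : {multiplicative H -> J}).
Hypotheses (phi_surj : forall y, exists x, phi x = y) (Jji : just_infinite J).

Let phi1 : phi 1 = 1.
Proof. by apply: (mulgI (phi 1)); rewrite -gmulfM !mulg1. Qed.

Let phiV x : phi x^-1 = (phi x)^-1.
Proof. by apply: (mulgI (phi x)); rewrite -gmulfM !mulgV. Qed.

Let phiJ x y : phi (x ^ y) = phi x ^ phi y.
Proof. by rewrite !gmulfM phiV. Qed.

Lemma is_normal_image (N : set H) : is_normal N -> is_normal (phi @` N).
Proof.
move=> [[N1 NM NV] nN]; split; first split.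
- by exists 1.
- by move=> _ _ [x Nx <-] [y Ny <-]; exists (x * y); [exact: NM|exact: gmulfM].
- by move=> _ [x Nx <-]; exists x^-1; [exact: NV|exact: phiV].
- move=> _ y [x Nx <-]; have [z <-] := phi_surj y.
  by exists (x ^ z); [exact: nN|exact: phiJ].
Qed.

Lemma finitely_generated_image : finitely_generated H -> finitely_generated J.
Proof.
move=> [s sgen]; exists (map phi s) => K sK y; have [x <-] := phi_surj y.
have [N NE] : exists N : groupClosed H, forall x, x \in N <-> phi x \in K.
  apply: groupClosed_of; split; first by rewrite phi1; exact: gpred1.
    by move=> a b aK bK; rewrite gmulfM; exact: gpredM.
  by move=> a aK; rewrite phiV gpredV.
by apply/NE/sgen => z zs; apply/NE/sK/map_f.
Qed.

(* Conjugating generators of [phi @` N] by [phi h] gives generators again; if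
   [phi @` M] is trivial, these commute with the original ones. *)
Lemma transversal_or_abelian (N M : set H) : finitely_generated H ->
    is_normal N -> is_normal M ->
    (forall F : seq H, (forall f, f \in F -> N f) ->
       exists h, forall f g, f \in F -> g \in F -> M [~ f, g ^ h]) ->
    has_transversal (phi @` N) ->
  has_transversal (phi @` M) \/ virtually_abelian J.
Proof.
move=> fgH nN nM comN tN; have nN' := is_normal_image nN.
have [[x Mx x1]|Mtriv] := pselect (exists2 x, (phi @` M) x & x != 1).
  left; apply: just_infinite_transversal => //; first exact: is_normal_image.
  by exists x.
right; apply: (virtually_abelian_of _ tN); first by case: nN'.
have [F FN Fgen] := finitely_generated_subgroup
  (finitely_generated_image fgH) (proj1 nN') tN.
have /choice[r rE] : forall y, exists x, y \in F -> N x /\ phi x = y.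
  move=> y; have [/FN[x Nx <-]|] := boolP (y \in F); first by exists x.
  by exists 1.
have [h comh] : exists h, forall f g, f \in F -> g \in F -> commute f (g ^ h).
  have [_ /mapP[y yF ->]|h hM] := comN (map r F); first by have [] := rE _ yF.
  exists (phi h) => f g fF gF; apply/commgP/contraT => fg.
  case: Mtriv; exists [~ f, g ^ phi h] => //.
  exists [~ r f, r g ^ h]; first exact: hM (map_f _ _) (map_f _ _).
  by rewrite !gmulfM !phiV !gmulfM !phiV (proj2 (rE _ fF)) (proj2 (rE _ gF)).
have comF g y : g \in F -> (phi @` N) y -> commute y (g ^ h).
  move=> gF; apply: (Fgen [set y | commute y (g ^ h)]) => [|f fF]; last exact: comh.
  split=> /= [|a b ca cb|a ca]; apply/commute_sym; first exact: commute1.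
    by apply: commuteM; exact/commute_sym.
  exact/commuteV/commute_sym.
have com y z : (phi @` N) y -> (phi @` N) z -> commute y (z ^ h).
  move=> Ny; apply: (Fgen [set z | commute y (z ^ h)]) => [|g gF]; last exact: comF.
  split=> /= [|a b ca cb|a ca]; first by rewrite conj1g; exact: commute1.
    by rewrite conjMg; exact: commuteM.
  by rewrite conjVg; exact: commuteV.
(* By normality [z] is itself a conjugate by [h] of an element of the image of [N]. *)
by move=> y z Ny Nz; rewrite -[z](conjgKV h); apply: com => //; apply nN'.2.
Qed.

End JustInfiniteQuotient.

(** * Finite covers of the line by intervals *)

Section IntervalCovers.
Local Open Scope ring_scope.
Variable R : realType.
Implicit Types (P Q : set R -> Prop) (f : R -> R) (A C : set R).

(** Unlike the pieces of [piecewise], these intervals may overlap or be empty, which makes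
    refinement easy. *)
Definition interval_cover P := exists s : seq (set R),
  (forall A, A \in s -> is_interval A /\ P A) /\ forall t, exists2 A, A \in s & A t.

Lemma interval_cover_sub P Q : (forall A, P A -> Q A) ->
  interval_cover P -> interval_cover Q.
Proof.
by move=> PQ [s [sP sc]]; exists s; split=> // A /sP[? /PQ].
Qed.

Lemma interval_coverI P Q : interval_cover P -> interval_cover Q ->
  interval_cover (fun C => exists A B, [/\ P A, Q B, C `<=` A & C `<=` B]).
Proof.
move=> [s [sP sc]] [r [rQ rc]]; exists [seq A `&` B | A <- s, B <- r]; split.
  move=> _ /allpairsP[[A B] [/= /sP[iA PA] /rQ[iB QB] ->]]; split.
    by move=> x y [? ?] [? ?] z ?; split; [apply: (iA x y)|apply: (iB x y)].
  by exists A, B.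
move=> t; have [A As At] := sc t; have [B Br Bt] := rc t.
by exists (A `&` B) => //; exact: allpairs_f.
Qed.

Lemma interval_cover_point (p : R) : interval_cover (fun C => C `<=` [set p] \/ ~ C p).
Proof.
exists [:: [set t | t < p]; [set p]; [set t | p < t]]; split=> [A|t].
  rewrite !inE => /or3P[]/eqP->; split.
  - by move=> x y /= _ yp z /andP[_ zy]; exact: le_lt_trans zy yp.
  - by right; rewrite /= ltxx.
  - by move=> x y /= -> -> z zp; apply/eqP; rewrite eq_le andbC.
  - by left.
  - by move=> x y /= px _ z /andP[xz _]; exact: lt_le_trans px xz.
  - by right; rewrite /= ltxx.
have [tp|tp|tp] := ltgtP t p.
- by exists [set t | t < p]; rewrite ?inE ?eqxx.
- by exists [set t | p < t]; rewrite ?inE ?eqxx ?orbT.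
- by exists [set p]; rewrite ?inE ?eqxx ?orbT.
Qed.

Lemma interval_cover_points (r : seq R) :
  interval_cover (fun C => forall p, p \in r -> C `<=` [set p] \/ ~ C p).
Proof.
elim: r => [|p r IHr].
  exists [:: setT]; split=> [A|t]; last by exists setT; rewrite ?inE.
  by rewrite inE => /eqP->.
apply: interval_cover_sub (interval_coverI (interval_cover_point p) IHr).
move=> C [A [B [Ap Br CA CB]]] q; rewrite inE => /predU1P[->|/Br[Bq|Bq]].
- by case: Ap => [Ap|Ap]; [left; exact: subset_trans CA Ap|right=> /CA].
- by left; exact: subset_trans CB Bq.
- by right=> /CB.
Qed.

(* The fixed points of a homography are the roots of a quadratic polynomial. *)
Lemma projective_fixed_points f A : projective_on f A ->
  exists p q, (forall t, A t -> f t = t) \/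
              (forall t, A t -> f t = t -> t = p \/ t = q).
Proof.
move=> [a [b [c [d [_ fE]]]]].
have quad t : A t -> f t = t -> c * t ^+ 2 + (d - a) * t - b = 0.
  move=> /fE[ct ->] /(congr1 ( *%R^~ (c * t + d))); rewrite divfK// => e.
  by have -> : c * t ^+ 2 + (d - a) * t - b =
    t * (c * t + d) - (a * t + b) by [ring]; rewrite e subrr.
have [[p [Ap fp]]|Np] := pselect (exists p, A p /\ f p = p); last first.
  by exists 0, 0; right=> t At ft; case: Np; exists t.
have [[q [[Aq fq] pq]]|Nq] := pselect (exists q, (A q /\ f q = q) /\ q != p); last first.
  exists p, p; right=> t At ft; left; have [//|tp] := eqVneq t p.
  by case: Nq; exists t.
exists p, q.
have [[t [[At ft] tp tq]]|Nt] :=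
    pselect (exists t, [/\ A t /\ f t = t, t != p & t != q]); last first.
  right=> t At ft; have [|tp] := eqVneq t p; first by left.
  by right; have [//|tq] := eqVneq t q; case: Nt; exists t.
left; have ep := quad p Ap fp; have eq := quad q Aq fq; have et := quad t At ft.
(* Divided differences: three distinct roots force [c = 0], [d = a] and [b = 0], so the homography
   is the identity. *)
have divd x y : x != y -> c * x ^+ 2 + (d - a) * x - b = 0 ->
    c * y ^+ 2 + (d - a) * y - b = 0 -> c * (x + y) + (d - a) = 0.
  move=> xy ex ey; apply: (mulfI (x := x - y)); first by rewrite subr_eq0.
  transitivity ((c * x ^+ 2 + (d - a) * x - b) - (c * y ^+ 2 + (d - a) * y - b)).
    by ring.
  by rewrite ex ey subrr mulr0.
have c0 : c = 0.
  apply: (mulIf (x := p - q)); first by rewrite subr_eq0 eq_sym.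
  transitivity ((c * (t + p) + (d - a)) - (c * (t + q) + (d - a))); first by ring.
  by rewrite (divd t p) ?(divd t q)// subrr mul0r.
have da : d - a = 0 by have := divd t p tp et ep; rewrite c0 mul0r add0r.
have b0 : b = 0 by apply/eqP; move/eqP: ep; rewrite c0 da !mul0r add0r sub0r oppr_eq0.
move=> s As; have [+ ->] := fE s As.
have -> : d = a by apply/eqP; rewrite -subr_eq0 da.
by rewrite c0 b0 mul0r add0r addr0 => a0; rewrite mulrAC divff// mul1r.
Qed.

(** A projective piece that is not fixed pointwise has at most two fixed points; cutting the line at
    all of these gives the cover. *)
Lemma interval_cover_fixed f : interval_cover (projective_on f) ->
  interval_cover (fun C => (forall t, C t -> f t = t) \/ (forall t, C t -> f t <> t)).
Proof.
move=> [s [sP sc]].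
have /choice[p /choice[q pq]] : forall A, exists p q, A \in s ->
    (forall t, A t -> f t = t) \/ (forall t, A t -> f t = t -> t = p \/ t = q).
  move=> A; have [/sP[_ /projective_fixed_points[p [q pq]]]|_] := boolP (A \in s).
    by exists p, q.
  by exists 0, 0.
pose r := map p s ++ map q s.
have sr : interval_cover (fun A => (forall t, A t -> f t = t) \/
    forall t, A t -> f t = t -> t \in r).
  exists s; split=> // A As; split; first by have [] := sP A As.
  have [?|Apq] := pq A As; [by left|right=> t At ft].
  by rewrite mem_cat; have [->|->] := Apq t At ft; rewrite map_f ?orbT.
apply: interval_cover_sub (interval_coverI sr (interval_cover_points r)).
move=> C [A [B [[Af|Ar] Br CA CB]]]; first by left=> t /CA/Af.
have [[t [Ct ft]]|N] := pselect (exists t, C t /\ f t = t); last first.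
  by right=> t Ct ft; apply: N; exists t.
have [Bt|Bt] := Br t (Ar t (CA t Ct) ft); last by case: Bt; exact: CB.
by left=> u /CB/Bt ->.
Qed.

Lemma interval_cover_common_fixed (I : eqType) (F : I -> R -> R) (S : seq I) :
    (forall i, interval_cover (projective_on (F i))) ->
  interval_cover (fun C => (forall t, C t -> forall i, i \in S -> F i t = t) \/
                           (forall t, C t -> exists2 i, i \in S & F i t <> t)).
Proof.
move=> FP; elim: S => [|i S IHS].
  by apply: interval_cover_sub (interval_cover_points [::]) => A _; left.
apply: interval_cover_sub (interval_coverI (interval_cover_fixed (FP i)) IHS).
move=> C [A [B [[Ai|Ai] [BS|BS] CA CB]]].
- left=> t Ct j; rewrite inE => /predU1P[->|]; [exact/Ai/CA|exact/BS/CB].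
- by right=> t /CB/BS[j jS ?]; exists j; rewrite // inE jS orbT.
- by right=> t /CA/Ai; exists i; rewrite // inE eqxx.
- by right=> t /CA/Ai; exists i; rewrite // inE eqxx.
Qed.

End IntervalCovers.

(** * Piecewise projective actions on the line *)

Section PiecewiseProjectiveAction.
Local Open Scope ring_scope.
Variables (R : realType) (H : groupType) (act : H -> R -> R).
Hypothesis act1 : forall t, act 1%g t = t.
Hypothesis actM : forall g h t, act (g * h)%g t = act g (act h t).
Hypothesis act_lt : forall g, {mono act g : x y / x < y}.
Hypothesis act_projective : forall g, interval_cover (projective_on (act g)).
Hypothesis act_faithful : forall g, (forall t, act g t = t) -> g = 1%g.
Hypothesis fgH : finitely_generated H.

Let actK g : cancel (act g) (act g^-1%g).
Proof. by move=> t; rewrite -actM mulVg act1. Qed.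

Let actVK g : cancel (act g^-1%g) (act g).
Proof. by move=> t; rewrite -actM mulgV act1. Qed.

Let act_le g : {mono act g : x y / x <= y}.
Proof. by move=> x y; rewrite !leNgt act_lt. Qed.

Lemma act_commg f g t : act [~ f, g]%g t = act (f^-1)%g (act (g^-1)%g (act f (act g t))).
Proof. by rewrite !actM. Qed.

Lemma act_conjg f h t : act (f ^ h)%g t = act (h^-1)%g (act f (act h t)).
Proof. by rewrite !actM. Qed.

(** * Convex hulls of orbits *)

Definition hull (x : R) : set R := [set y | exists g h, act g x <= y <= act h x].

Lemma hull_refl x : hull x x.
Proof. by exists 1%g, 1%g; rewrite act1 lexx. Qed.

Lemma hull_act x g y : hull x (act g y) <-> hull x y.
Proof.
have hact k z : hull x z -> hull x (act k z).
  by move=> [a [b azb]]; exists (k * a)%g, (k * b)%g; rewrite !actM !act_le.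
by split; [move/(hact g^-1%g _); rewrite actK|exact: hact].
Qed.

(** Some [act g x] lies below [u] and some [act k x] above [v], so [k * g^-1] moves [u] beyond
    [v]. *)
Lemma hull_orbit_le x u v : hull x u -> hull x v -> exists h, v <= act h u.
Proof.
move=> [g [_ /andP[gu _]]] [_ [k /andP[_ vk]]]; exists (k * g^-1)%g.
by rewrite actM (le_trans vk)// act_le -(act_le g) actVK.
Qed.

Lemma hull_fixed x y : hull x y -> (forall g, act g y = y) -> x = y.
Proof.
move=> [g [h /andP[gx hx]]] fy; apply/eqP; rewrite eq_le.
by rewrite -(act_le g) fy gx -(act_le h) fy hx.
Qed.

(* Otherwise the supremum of the orbit of [x] would be fixed. *)
Lemma orbit_reaches (C : set R) x y : is_interval C ->
    (forall t, C t -> exists g, act g t <> t) -> C x -> C y -> x <= y ->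
  exists h, y <= act h x.
Proof.
move=> iC Cmoved Cx Cy xy; apply: contrapT => N.
have orb_lt h : act h x < y by rewrite ltNge; apply/negP => yh; apply: N; exists h.
pose E := [set act h x | h in [set: H]]; pose s := sup E.
have hE : has_sup E.
  by split; [exists x, 1%g|exists y => _ [h _ <-]; exact/ltW].
have Es h : act h x <= s by apply: ub_le_sup; [case: hE|exists h].
(* The orbit is invariant, so [act g s] is again an upper bound; using [g^-1] as well, [s] is
   fixed. *)
have s_le g : s <= act g s.
  apply: ge_sup => [|_ [h _ <-]]; first by case: hE.
  by rewrite -(act_le g^-1%g) -actM actK.
have Cs : C s.
  apply: (iC x y) => //; rewrite -{1}(act1 x) Es/=.
  by apply: ge_sup => [|_ [h _ <-]]; [case: hE|exact/ltW].
have [g []] := Cmoved s Cs; apply/eqP; rewrite eq_le s_le andbT.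
by rewrite -(act_le g^-1%g) actK.
Qed.

Lemma hull_interval (C : set R) x y : is_interval C ->
    (forall t, C t -> exists g, act g t <> t) -> C x -> C y -> hull x y.
Proof.
move=> iC Cm Cx Cy; have [xy|/ltW yx] := leP x y.
  by have [h yh] := orbit_reaches iC Cm Cx Cy xy; exists 1%g, h; rewrite act1 xy.
have [h xh] := orbit_reaches iC Cm Cy Cx yx; exists h^-1%g, 1%g.
by rewrite act1 yx -(act_le h) actVK xh.
Qed.

(** The line is covered by finitely many intervals, each fixed pointwise by the generators or
    without common fixed points. An interval of the second kind lies in one hull, so one point of
    each suffices. *)
Lemma hull_representatives : exists X : seq R,
  (forall x, x \in X -> exists g, act g x <> x) /\
  forall t, (exists g, act g t <> t) -> exists2 x, x \in X & hull x t.
Proof.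
have [S Sgen] := fgH.
have [s [sP sc]] := interval_cover_common_fixed S act_projective.
have fixS t : (forall g, g \in S -> act g t = t) -> forall g, act g t = t.
  move=> St; have [N NE] : exists N : groupClosed H, forall g, g \in N <-> act g t = t.
    apply: groupClosed_of; split=> [|g h gt ht|g gt]; first exact: act1.
      by rewrite /= actM ht gt.
    by rewrite /= -[in LHS]gt actK.
  by move=> g; apply/NE/Sgen => h /St/NE.
suff [X [Xm XP]] : exists X : seq R, (forall x, x \in X -> exists g, act g x <> x) /\
    forall A t, A \in s -> A t -> (exists g, act g t <> t) ->
      exists2 x, x \in X & hull x t.
  by exists X; split=> // t tm; have [A As At] := sc t; exact: XP At tm.
elim: s sP {sc} => [|A s IHs] sP; first by exists [::]; split.
have [X0 [X0m X0c]] : exists X : seq R, (forall x, x \in X -> exists g, act g x <> x) /\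
    forall t, (exists g, act g t <> t) -> A t -> exists2 x, x \in X & hull x t.
  have [|iA [Af|Am]] := sP A; first by rewrite inE eqxx.
    by exists [::]; split=> // t [g gt] At; case: gt; exact/fixS/Af.
  have Am' t : A t -> exists g, act g t <> t by move=> /Am[g]; exists g.
  have [[x Ax]|A0] := pselect (A !=set0); last first.
    by exists [::]; split=> // t _ At; case: A0; exists t.
  exists [:: x]; split=> [y|t _ At]; first by rewrite inE => /eqP->; exact: Am'.
  by exists x; [rewrite inE|exact: hull_interval iA Am' Ax At].
have [B Bs|X [Xm XP]] := IHs; first by apply: sP; rewrite inE Bs orbT.
exists (X0 ++ X); split=> [x|B t].
  by rewrite mem_cat => /orP[/X0m|/Xm].
rewrite inE => /predU1P[->|Bs] Bt tm.
  by have [x xX ?] := X0c t tm Bt; exists x; rewrite // mem_cat xX.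
by have [x xX ?] := XP B t Bs Bt tm; exists x; rewrite // mem_cat xX orbT.
Qed.

(** * Germs and charts at an end of a hull *)

Section HullEnd.
Variables (b : bool) (x : R).
Local Notation sgn := ((-1) ^+ b : R).

Let sgn_act_le g s t : (sgn * act g s <= sgn * act g t) = (sgn * s <= sgn * t).
Proof. by case: b; rewrite /= ?expr1 ?mulN1r ?lerN2 ?expr0 ?mul1r act_le. Qed.

(* [b = false] stands for the left end of [hull x], [b = true] for the right end. *)
Definition near_end (P : set R) :=
  exists2 u, hull x u & forall t, hull x t -> sgn * t <= sgn * u -> P t.

Lemma near_endT (P : set R) : (forall t, hull x t -> P t) -> near_end P.
Proof. by move=> hP; exists x => [|t /hP]; first exact: hull_refl. Qed.

Lemma near_endI (P Q : set R) : near_end P -> near_end Q -> near_end (P `&` Q).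
Proof.
move=> [u hu uP] [v hv vQ]; have [uv|/ltW vu] := leP (sgn * u) (sgn * v).
  by exists u => // t ht tu; split; [exact: uP|exact/vQ/(le_trans tu)].
by exists v => // t ht tv; split; [exact/uP/(le_trans tv)|exact: vQ].
Qed.

Lemma near_end_sub (P Q : set R) : (forall t, hull x t -> P t -> Q t) ->
  near_end P -> near_end Q.
Proof. by move=> PQ [u hu uP]; exists u => // t ht tu; exact/PQ/uP. Qed.

Lemma near_end_act g (P : set R) : near_end P -> near_end (fun t => P (act g t)).
Proof.
move=> [u hu uP]; exists (act g^-1%g u); first exact/hull_act.
move=> t ht tu; apply: uP; first exact/hull_act.
by rewrite -[u](actVK g) sgn_act_le.
Qed.

Lemma near_end_ex (P : set R) : near_end P -> exists2 t, hull x t & P t.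
Proof. by move=> [u hu uP]; exists u => //; exact: uP. Qed.

Lemma near_end_all (I : eqType) (s : seq I) (P : I -> set R) :
  (forall i, i \in s -> near_end (P i)) ->
  near_end (fun t => forall i, i \in s -> P i t).
Proof.
elim: s => [|i s IHs] sP; first exact: near_endT.
have nPi : near_end (P i) by apply: sP; rewrite inE eqxx.
have nPs : near_end (fun t => forall j, j \in s -> P j t).
  by apply: IHs => j js; apply: sP; rewrite inE js orbT.
have [u hu uP] := near_endI nPi nPs; exists u => // t ht tu j.
by have [Pi Ps] := uP t ht tu; rewrite inE => /predU1P[->|/Ps].
Qed.

(** If [A] has points arbitrarily close to the end, then by convexity it contains everything between
    them. *)
Lemma near_end_interval (A : set R) : is_interval A ->
  near_end A \/ near_end (~` A).
Proof.
move=> iA; have [|N] := pselect (near_end (~` A)); first by right.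
have meetA u : hull x u -> exists t, [/\ hull x t, sgn * t <= sgn * u & A t].
  move=> hu; apply: contrapT => Nu; apply: N; exists u => // t ht tu At.
  by apply: Nu; exists t.
left; have [u [hu _ Au]] := meetA x (hull_refl x).
exists u => // t ht tu; have [v [hv vt Av]] := meetA t ht.
move: vt tu; case: b; rewrite ?expr1 ?mulN1r ?lerN2 ?expr0 ?mul1r => vt tu.
  by apply: (iA u v) => //; rewrite tu.
by apply: (iA v u) => //; rewrite vt.
Qed.

(** One of the finitely many pieces contains a neighbourhood of the end; otherwise their complements
    would all do so and would have a common point. *)
Lemma near_end_projective g : exists p q r s, p * s - q * r = 1 /\
  near_end (fun t => r * t + s != 0 /\ act g t = (p * t + q) / (r * t + s)).
Proof.
have [S [SP Sc]] := act_projective g.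
have [[A [AS nA]]|N] := pselect (exists A, A \in S /\ near_end A).
  have [_ [p [q [r [s [det E]]]]]] := SP A AS.
  by exists p, q, r, s; split=> //; apply: near_end_sub nA => t _ /E.
have /near_end_ex[t _ Nt] : near_end (fun t => forall A, A \in S -> (~` A) t).
  apply: near_end_all => A AS; have [nA|//] := near_end_interval (proj1 (SP A AS)).
  by case: N; exists A.
by have [A AS At] := Sc t; case: (Nt A AS).
Qed.

(* A coordinate in which the germs of [H] at the end are affine maps. *)
Definition end_chart (w : R -> R) :=
  (forall s t, hull x s -> hull x t -> w s = w t -> s = t) /\
  forall g, exists k m, k != 0 /\ near_end (fun t => w (act g t) = k * w t + m).

(* The end is a point [p] fixed by [H], sent to infinity by the chart. *)
Lemma end_chart_bounded m : (exists g, act g x <> x) ->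
  (forall t, hull x t -> sgn * m <= sgn * t) -> exists w, end_chart w.
Proof.
move=> [g0 g0x] lbm; pose E := [set sgn * t | t in hull x].
have sgnK t : sgn * (sgn * t) = t by rewrite mulrA -expr2 sqrr_sign mul1r.
have hE : has_inf E.
  split; first by exists (sgn * x), x; [exact: hull_refl|].
  by exists (sgn * m) => _ [t ht <-]; exact: lbm.
pose p := sgn * inf E.
have p_le t : hull x t -> sgn * p <= sgn * t.
  by move=> ht; rewrite sgnK; apply: ge_inf; [case: hE|exists t].
have p_dist t : hull x t -> `|t - p| = sgn * t - sgn * p.
  move=> ht; have tp : 0 <= sgn * (t - p) by rewrite mulrBr subr_ge0 p_le.
  by rewrite -mulrBr -[RHS](ger0_norm tp) normrM normr_sign mul1r.
(* If the hull contained its endpoint [p], then [p] would be fixed by [H], hence equal to [x], which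
   is moved. *)
have pN t : hull x t -> t != p.
  move=> ht; apply/eqP => tp; rewrite tp in ht; apply: g0x.
  have fp g : act g p = p.
    have le_act h : sgn * p <= sgn * act h p by apply/p_le/hull_act.
    have : sgn * act g p = sgn * p.
      apply/eqP; rewrite eq_le le_act andbT.
      by rewrite -(sgn_act_le g^-1%g) actK le_act.
    by move=> /(congr1 ( *%R sgn)); rewrite !sgnK.
  by have -> : x = p by exact: hull_fixed ht fp.
exists (fun t => (t - p)^-1); split=> [s t hs ht /invr_inj/addIr //|g].
have [a [b' [c [d [det nE]]]]] := near_end_projective g.
(* letting [t] tend to [p] in [act g t * (c * t + d) = a * t + b'] *)
have q0 : a * p + b' - p * (c * p + d) = 0.
  set q := LHS.
  pose C := `|a| + `|p * c| + (`|c| * (`|p| + 1) + `|d|).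
  have C0 : 0 <= C by rewrite !addr_ge0// ?mulr_ge0// addr_ge0.
  have qC e : 0 < e -> e <= 1 -> `|q| <= e * C.
    move=> e0 e1.
    have near_p : near_end (fun t => `|t - p| <= e).
      have [_ [y hy <-] ye] : exists2 z, E z & z < inf E + e.
        by apply: inf_adherent.
      exists y => // t ht ty; rewrite p_dist// lerBlDl sgnK.
      exact/ltW/(le_lt_trans ty).
    have [t ht [[ct ft] [te fte]]] :=
      near_end_ex (near_endI nE (near_endI near_p (near_end_act g near_p))).
    have -> : q = a * (p - t) + (act g t - p) * (c * t + d) + p * c * (t - p).
      have fE : act g t * (c * t + d) = a * t + b' by rewrite ft divfK.
      transitivity (q + (act g t * (c * t + d) - (a * t + b'))).
        by rewrite fE subrr addr0.
      by rewrite /q; ring.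
    have tp1 : `|c * t + d| <= `|c| * (`|p| + 1) + `|d|.
      rewrite (le_trans (ler_normD _ _))// lerD2r normrM ler_wpM2l//.
      by rewrite -[t](subrKC p) (le_trans (ler_normD _ _))// lerD2l (le_trans te).
    rewrite (le_trans (ler_normD _ _))// (le_trans (lerD (ler_normD _ _) (lexx _)))//.
    rewrite normrM (distrC p) normrM [X in _ + X]normrM /C.
    have -> : e * (`|a| + `|p * c| + (`|c| * (`|p| + 1) + `|d|)) =
      `|a| * e + e * (`|c| * (`|p| + 1) + `|d|) + `|p * c| * e by ring.
    rewrite lerD ?ler_wpM2l//.
    by rewrite lerD ?ler_wpM2l// ler_pM.
  apply/eqP/contraT => qN0.
  have q_gt0 : 0 < `|q| by rewrite normr_gt0.
  (* This choice gives [e <= 1] and [e * C < |q|], against [qC]. *)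
  pose e := `|q| / (2 * (`|q| + C)).
  have D0 : 0 < 2 * (`|q| + C) by rewrite mulr_gt0// ltr_wpDr.
  have := qC e; rewrite /e divr_gt0// ler_pdivrMr// mul1r.
  have -> : `|q| <= 2 * (`|q| + C) by lra.
  move=> /(_ isT isT); rewrite mulrAC ler_pdivlMr// -ler_pdivlMl//.
  by rewrite mulKf ?gt_eqF//; lra.
(* By [q0] the vector [(p, 1)] is an eigenvector of the matrix of [g]; the two factors are the
   eigenvalues, with product the determinant. *)
have ap : (a - p * c) * (c * p + d) = 1.
  by rewrite -det -[RHS]addr0 -(mulr0 c) -q0; ring.
have k0 : c * p + d != 0.
  by apply: contra_eq_neq ap => ->; rewrite mulr0 eq_sym oner_neq0.
have a0 : a - p * c != 0.
  by apply: contra_eq_neq ap => ->; rewrite mul0r eq_sym oner_neq0.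
(* Read off from [act g t - p = (a - p * c) * (t - p) / (c * t + d)] and
   [c * t + d = c * (t - p) + (c * p + d)]. *)
exists ((c * p + d) / (a - p * c)), (c / (a - p * c)); split.
  by rewrite mulf_neq0// invr_neq0.
apply: near_end_sub nE => t ht [ct ft].
have tp : t - p != 0 by rewrite subr_eq0 pN.
have -> : act g t - p = (a - p * c) * (t - p) / (c * t + d).
  rewrite ft -[p in LHS](mulfK ct) -mulrBl; congr (_ / _).
  by apply/eqP; rewrite -subr_eq0 -q0; apply/eqP; ring.
by field; rewrite ?ct ?a0 ?tp.
Qed.

(** Here the end is already at infinity, and a homography that fixes infinity is affine, so the
    identity is a chart. *)
Lemma end_chart_unbounded :
  (forall m, exists2 t, hull x t & sgn * t < sgn * m) -> exists w, end_chart w.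
Proof.
move=> unb; exists id; split=> // g.
have [p [q [r [s [det nE]]]]] := near_end_projective g.
have near_infty m : 0 <= m -> near_end (fun t => m < `|t|).
  move=> m0; have [u hu um] := unb (sgn * - m).
  rewrite mulrA -expr2 sqrr_sign mul1r in um.
  exists u => // t ht /le_lt_trans/(_ um); rewrite ltrNr => tm.
  rewrite (lt_le_trans tm)// (le_trans (ler_norm _))//.
  by rewrite normrN normrM normr_sign mul1r.
(* otherwise both factors of [(r * act g t - p) * (r * t + s) = -1] are unbounded *)
have r0 : r = 0.
  apply/eqP/contraT => r0.
  (* Once [|t|] and [|act g t|] exceed [m], both factors exceed 1 in absolute value. *)
  pose m := (1 + `|p| + `|s|) / `|r|.
  have rgt0 : 0 < `|r| by rewrite normr_gt0.
  have m0 : 0 <= m by rewrite divr_ge0// !addr_ge0.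
  have [t ht [[rt ft] [mt mft]]] := near_end_ex
    (near_endI nE (near_endI (near_infty m m0) (near_end_act g (near_infty m m0)))).
  have big y z : m < `|y| -> `|z| <= `|p| + `|s| -> 1 < `|r * y + z|.
    rewrite ltr_pdivrMr// => my zps.
    have := lerB_normD (r * y) z; rewrite normrM (mulrC `|r|); lra.
  have e : (r * act g t - p) * (r * t + s) = -1.
    by rewrite ft -det; field.
  have t1 := big t s mt (ler_wpDl (normr_ge0 _) (lexx _)).
  have ft1 := big (act g t) (- p) mft; rewrite normrN in ft1.
  have {}ft1 := ft1 (ler_wpDr (normr_ge0 _) (lexx _)).
  have := ltr_pM ler01 ler01 ft1 t1.
  by rewrite mulr1 -normrM e normrN normr1 ltxx.
rewrite r0 mulr0 subr0 in det.
have s0 : s != 0 by apply: contra_eq_neq det => ->; rewrite mulr0 eq_sym oner_neq0.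
have p0 : p != 0 by apply: contra_eq_neq det => ->; rewrite mul0r eq_sym oner_neq0.
exists (p / s), (q / s); split; first by rewrite mulf_neq0// invr_neq0.
by apply: near_end_sub nE => t _ [_ ->]; rewrite r0 mul0r add0r; field.
Qed.

Lemma end_chart_exists : (exists g, act g x <> x) -> exists w, end_chart w.
Proof.
move=> mx.
have [[m lbm]|N] := pselect (exists m, forall t, hull x t -> sgn * m <= sgn * t).
  exact: end_chart_bounded mx lbm.
apply: end_chart_unbounded => m; apply: contrapT => Nm; apply: N; exists m => t ht.
by rewrite leNgt; apply/negP => tm; apply: Nm; exists t.
Qed.

End HullEnd.

(** * The normal subgroups of the chain *)

(** Quantifying over all charts avoids choosing one; a chart exists whenever [x] is moved. *)
Definition germ_translation b x : set H := [set f | forall w, end_chart b x w ->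
  exists m, near_end b x (fun t => w (act f t) = w t + m)].

Definition germ_trivial b x : set H := [set f | near_end b x (fun t => act f t = t)].

Definition trivial_on_hull x : set H := [set f | forall t, hull x t -> act f t = t].

Lemma is_normal_germ_translation b x : is_normal (germ_translation b x).
Proof.
split; first split.
- by move=> w _; exists 0; apply: near_endT => t _; rewrite act1 addr0.
- move=> f g fT gT w wc; have [m nf] := fT w wc; have [n ng] := gT w wc.
  exists (n + m); apply: near_end_sub (near_endI (near_end_act g nf) ng).
  by move=> t _ [fE gE]; rewrite actM fE gE addrA.
- move=> f fT w wc; have [m nf] := fT w wc; exists (- m).
  apply: near_end_sub (near_end_act f^-1%g nf) => t _.
  by rewrite actVK => ->; rewrite addrK.
move=> f g fT w wc; have [m nf] := fT w wc.
(* Conjugating a translation by [m] by an affine map of slope [k] gives a translation by [m / k]. *)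
have [k [n [k0 ng]]] := wc.2 g; exists (m / k).
apply: near_end_sub (near_endI ng
  (near_endI (near_end_act g nf) (near_end_act (f ^ g)%g ng))) => t _ [gE [fE fgE]].
move: fgE; rewrite act_conjg actVK fE gE => e; apply: (mulfI k0).
by apply: (addIr n); rewrite -e; field.
Qed.

Lemma is_normal_germ_trivial b x : is_normal (germ_trivial b x).
Proof.
split; first split.
- by apply: near_endT => t _; exact: act1.
- move=> f g fT gT; apply: near_end_sub (near_endI fT gT) => t _ [fE gE].
  by rewrite actM gE fE.
- by move=> f fT; apply: near_end_sub fT => t _ fE; rewrite -[in LHS]fE actK.
move=> f g fT; apply: near_end_sub (near_end_act g fT) => t _ fE.
by rewrite act_conjg fE actK.
Qed.

Lemma is_normal_trivial_on_hull x : is_normal (trivial_on_hull x).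
Proof.
split; first split.
- by move=> t _; exact: act1.
- by move=> f g fT gT t ht; rewrite actM gT// fT.
- by move=> f fT t ht; rewrite -[in LHS](fT t ht) actK.
by move=> f g fT t ht; rewrite act_conjg fT ?actK//; exact/hull_act.
Qed.

Lemma commg_germ_translation b x f g : germ_translation b x [~ f, g]%g.
Proof.
move=> w wc; have [k [m [k0 nf]]] := wc.2 f; have [l [n [l0 ng]]] := wc.2 g.
(* In the chart, [f] followed by [g] and [g] followed by [f] have the same slope [l * k]. The
   constant solves [g f [f, g] = f g], an identity that involves no germs of inverses. *)
exists ((k * n + m - (l * m + n)) / (l * k)).
have nc := near_end_act [~ f, g]%g (near_endI nf (near_end_act f ng)).
apply: near_end_sub (near_endI nc (near_endI ng (near_end_act g nf))) => t _.
move=> [[fE gE] [gE' fE']].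
have e : act g (act f (act [~ f, g]%g t)) = act f (act g t).
  by rewrite act_commg !actVK.
rewrite e fE' gE' fE in gE; apply: (mulfI l0); apply: (mulfI k0); apply: (addIr (l * m + n)).
transitivity (k * (l * w t + n) + m); last by field; rewrite l0 k0.
by rewrite gE; ring.
Qed.

(** Translations commute, so the commutator is the identity in a chart, and charts are injective on
    the hull. *)
Lemma commg_germ_trivial b x f g : (exists g, act g x <> x) ->
  germ_translation b x f -> germ_translation b x g -> germ_trivial b x [~ f, g]%g.
Proof.
move=> mx fT gT; have [w wc] := end_chart_exists b mx.
have [m nf] := fT w wc; have [n ng] := gT w wc.
have nc := near_end_act [~ f, g]%g (near_endI nf (near_end_act f ng)).
apply: near_end_sub (near_endI nc (near_endI ng (near_end_act g nf))) => t ht.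
move=> [[fE gE] [gE' fE']]; apply: wc.1 => //; first exact/hull_act.
have e : act g (act f (act [~ f, g]%g t)) = act f (act g t).
  by rewrite act_commg !actVK.
rewrite e fE' gE' fE in gE; apply: (addIr (m + n)).
by rewrite addrA -gE -!addrA (addrC m).
Qed.

(* If [u, v] contains the supports of the elements of [F] in the hull and [h]
   moves [u] beyond [v], then [F] and its conjugate by [h] have disjoint supports. *)
Lemma commg_trivial_on_hull x (F : seq H) :
    (forall f, f \in F -> forall b, germ_trivial b x f) ->
  exists h, forall f g, f \in F -> g \in F -> trivial_on_hull x [~ f, g ^ h]%g.
Proof.
move=> FT.
have [u hu uF] := near_end_all (fun f fF => FT f fF false).
have [v hv vF] := near_end_all (fun f fF => FT f fF true).
have {}uF f t : f \in F -> hull x t -> t <= u -> act f t = t.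
  by move=> fF ht tu; apply: uF fF => //; rewrite !mul1r.
have {}vF f t : f \in F -> hull x t -> v <= t -> act f t = t.
  by move=> fF ht vt; apply: vF fF => //; rewrite expr1 !mulN1r lerN2.
(* As [g ^ h] means [h^-1 g h], conjugating by [h^-1] carries the support of [g] beyond
   [act h u]. *)
have [h vhu] := hull_orbit_le hu hv; exists h^-1%g => f g fF gF t ht.
have hhu : hull x (act h u) by exact/hull_act.
have gE s : act (g ^ h^-1)%g s = act h (act g (act h^-1%g s)).
  by rewrite act_conjg invgK.
have gT s : hull x s -> s <= act h u -> act (g ^ h^-1)%g s = s.
  move=> hs shu; rewrite gE (uF g) ?actVK//; first exact/hull_act.
  by rewrite -(act_le h) actVK.
suff e : act f (act (g ^ h^-1)%g t) = act (g ^ h^-1)%g (act f t).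
  by rewrite act_commg e !actK.
(* Below [act h u] the conjugate is trivial and [f] preserves this part of the hull; above it the
   roles are exchanged. *)
have [thu|/ltW hut] := leP t (act h u).
  rewrite gT// gT//; first exact/hull_act.
  have [tv|vt] := leP t v; last by rewrite vF// ltW.
  by rewrite (le_trans _ vhu)// -[X in _ <= X](vF f)// act_le.
have vt := le_trans vhu hut.
rewrite (vF f t)// vF//; first exact/hull_act.
by rewrite (le_trans vhu)// -(gT (act h u))// act_le.
Qed.

Theorem elementarily_just_infinite_action : elementarily_just_infinite H.
Proof.
move=> J phi phi_surj Jji; have [X [Xm XP]] := hull_representatives.
pose D : set (bool * R) := [set i | i.2 \in X].
pose K1 := \bigcap_(i in D) germ_translation i.1 i.2.
pose K2 := \bigcap_(i in D) germ_trivial i.1 i.2.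
(* The last terms of the chain treat one hull at a time: [K] starts at [K2] for empty [Y] and
   decreases as [Y] grows to [X]. *)
pose K (Y : seq R) := K2 `&` \bigcap_(x in [set x : R | x \in Y]) trivial_on_hull x.
have nK1 : is_normal K1.
  by apply: is_normal_bigcap => i _; exact: is_normal_germ_translation.
have nK2 : is_normal K2.
  by apply: is_normal_bigcap => i _; exact: is_normal_germ_trivial.
have nK Y : is_normal (K Y).
  by apply: is_normal_setI => //; apply: is_normal_bigcap => x _;
    exact: is_normal_trivial_on_hull.
have nT : is_normal [set: H] by [].
have step := transversal_or_abelian phi_surj Jji fgH.
have tT : has_transversal (phi @` [set: H]).
  exists [:: 1%g] => y; exists 1%g; rewrite ?inE//.
  by have [x <-] := phi_surj (1^-1 * y)%g; exists x.
have [|K1f|//] := step _ _ nT nK1 _ tT.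
  by move=> F _; exists 1%g => f g _ _ i _; exact: commg_germ_translation.
have [|K2f|//] := step _ _ nK1 nK2 _ K1f.
  move=> F FK1; exists 1%g => f g fF gF i Di; rewrite conjg1.
  by apply: commg_germ_trivial; [exact: Xm|exact: FK1|exact: FK1].
have [Xf|//] : has_transversal (phi @` K X) \/ virtually_abelian J.
  have : {subset X <= X} by [].
  elim: {1 3}X => [|x Y IHY] YX.
    by left; rewrite /K set_nil bigcap_set0 setIT.
  have [y yY|Yf|] := IHY; [by apply: YX; rewrite inE yY orbT| |by right].
  apply: step (nK Y) (nK (x :: Y)) _ Yf => F FY.
  have [f /FY[fK2 _] b|h hP] := @commg_trivial_on_hull x F.
    by apply: (fK2 (b, x)); apply: YX; rewrite /= inE eqxx.
  exists h => f g fF gF.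
  have [[_ KM KV] KJ] := nK Y; have KYf := FY f fF.
  (* Normality of [K Y] keeps the commutator trivial on the hulls treated before. *)
  have : K Y [~ f, g ^ h]%g by exact: KM (KV _ KYf) (KJ _ _ KYf).
  move=> [K2c Yc]; split=> // y; rewrite /= inE => /predU1P[->|/Yc//].
  exact: hP.
apply: virtually_abelian_of Xf _; first exact: (is_normal_image phi_surj (nK X)).1.
(* Every moved point lies in a hull of some [x] in [X], so [K X] is trivial by faithfulness. *)
suff KX1 f : K X f -> f = 1%g by move=> _ _ [f /KX1-> <-] [g /KX1-> <-].
move=> [_ fX]; apply: act_faithful => t; apply: contrapT => ft.
have [|x xX ht] := XP t; first by exists f.
by apply: ft; exact: fX ht.
Qed.

End PiecewiseProjectiveAction.

(** * The groups PL^+[0,1] and H(R) *)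

Section Applications.
Local Open Scope ring_scope.
Variable R : realType.

Lemma interval_cover_of_piecewise (D : set R) P : piecewise D P ->
  exists s : seq (set R), [/\ forall A, A \in s -> is_interval A /\ P A,
    forall A, A \in s -> A `<=` D & forall t, D t -> exists2 A, A \in s & A t].
Proof.
move=> [Pi [/finite_seqP[s sE] [cPi _ _] PiP]].
have PiE A : Pi A = (A \in s) by rewrite sE.
exists s; split=> [A|A|t].
- by rewrite -PiE; exact: PiP.
- by rewrite -PiE -cPi => PiA t At; exists A.
- by rewrite -cPi => -[A PiA At]; exists A; rewrite -?PiE.
Qed.

Lemma LEJI_MonodH : LEJI (MonodH R).
Proof.
move=> H fgH; pose act (h : subgroup H) : R -> R := \val (\val h).
apply: (@elementarily_just_infinite_action R _ act) => //.
- by move=> g; have /asboolP[] := valP (\val g).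
- move=> g; have /asboolP[_] := valP (\val g).
  by move=> /interval_cover_of_piecewise[s [sP _ sc]]; exists s; split=> // t; exact: sc.
- by move=> g gE; do 2 apply/val_inj; exact: homeoP.
Qed.

Local Notation I01 := (`[0, 1]%classic : set R).

Definition extend_id (f : I01 -> I01) (t : R) : R :=
  if pselect (I01 t) is left It then \val (f (SigSub (mem_set It))) else t.

Lemma extend_id_val f (x : I01) : extend_id f (\val x) = \val (f x).
Proof.
rewrite /extend_id; case: pselect => [It|[]]; last exact: set_valP.
by congr (\val (f _)); exact: val_inj.
Qed.

Lemma extend_id_out f t : ~ I01 t -> extend_id f t = t.
Proof. by rewrite /extend_id; case: pselect. Qed.

Lemma I01P t : I01 t -> exists x : I01, \val x = t.
Proof. by move=> It; exists (SigSub (mem_set It)). Qed.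

Lemma extend_id_mono f : {mono f : x y / \val x < \val y} ->
  {mono extend_id f : x y / x < y}.
Proof.
move=> fm; apply: leW_mono; apply: le_mono => s t st.
have I01E u : I01 u <-> 0 <= u <= 1 by rewrite /= in_itv.
have [/I01P[x xs]|Is] := pselect (I01 s); have [/I01P[y yt]|It] := pselect (I01 t).
- by rewrite -xs -yt !extend_id_val fm xs yt.
- rewrite -xs extend_id_val (extend_id_out _ It).
  have /I01E/andP[s0 _] : I01 s by rewrite -xs; exact: set_valP.
  have /I01E/andP[_ f1] := set_valP (f x).
  apply: le_lt_trans f1 _; rewrite ltNge; apply/negP => t1.
  by apply: It; apply/I01E; rewrite t1 (le_trans s0 (ltW st)).
- rewrite -yt extend_id_val (extend_id_out _ Is).
  have /I01E/andP[_ t1] : I01 t by rewrite -yt; exact: set_valP.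
  have /I01E/andP[f0 _] := set_valP (f y).
  apply: lt_le_trans f0; rewrite ltNge; apply/negP => s0.
  by apply: Is; apply/I01E; rewrite s0 (le_trans (ltW st) t1).
- by rewrite !extend_id_out.
Qed.

(** Dividing numerator and denominator of [(a * t + b) / 1] by the square root of [a] makes the
    determinant 1. *)
Lemma projective_affine (f : R -> R) (A : set R) a b : 0 < a ->
  (forall t, A t -> f t = a * t + b) -> projective_on f A.
Proof.
move=> a0 fE; have r0 : Num.sqrt a != 0 by rewrite gt_eqF// sqrtr_gt0.
have ra : Num.sqrt a * Num.sqrt a = a by rewrite -expr2 sqr_sqrtr// ltW.
exists (Num.sqrt a), (b / Num.sqrt a), 0, (Num.sqrt a)^-1; split.
  by rewrite mulr0 subr0 divff.
move=> t At; rewrite mul0r add0r invr_neq0// invrK; split=> //.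
by rewrite fE// mulrDl divfK// mulrAC ra.
Qed.

Lemma extend_id_projective f : {mono f : x y / \val x < \val y} ->
  piecewise I01 (affine_on f) -> interval_cover (projective_on (extend_id f)).
Proof.
move=> fm /interval_cover_of_piecewise[s [sP sI sc]].
have idP A : A `<=` ~` I01 -> projective_on (extend_id f) A.
  move=> AI; apply: (@projective_affine _ _ 1 0) => // t At.
  by rewrite mul1r addr0; apply: extend_id_out; exact: AI.
exists ([set t | t < 0] :: [set t | 1 < t] :: s); split=> [A|t].
  rewrite !inE => /or3P[/eqP->|/eqP->|As].
  - split; first by move=> x y /= _ y0 z /andP[_ zy]; exact: le_lt_trans zy y0.
    by apply: idP => t /= t0; rewrite in_itv /= leNgt t0.
  - split; first by move=> x y /= x1 _ z /andP[xz _]; exact: lt_le_trans x1 xz.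
    by apply: idP => t /= t1; rewrite in_itv /= (leNgt t) t1 andbF.
  have [iA [a [b fE]]] := sP A As; split=> //.
  have [a0|a0] := ltP 0 a.
    apply: (@projective_affine _ _ a b) => // t At.
    by have [x xt] := I01P (sI A As t At); rewrite -xt extend_id_val fE// xt.
  (* a piece on which [f] has slope [a <= 0] has at most one point *)
  have A1 (x y : I01) : A (\val x) -> A (\val y) -> \val y <= \val x.
    move=> Ax Ay; rewrite leNgt; apply/negP => xy.
    have := xy; rewrite -fm (fE x Ax) (fE y Ay) ltrD2r ltNge => /negP; apply.
    by rewrite ler_wnM2l// ltW.
  have [[t At]|A0] := pselect (exists t, A t).
    (* At a single point a translation agrees with [f]. *)
    apply: (@projective_affine _ _ 1 (extend_id f t - t)) => // u Au.
    have [x xt] := I01P (sI A As t At); have [y yu] := I01P (sI A As u Au).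
    rewrite mul1r addrC -xt -yu in At Au *.
    have -> : y = x by apply/val_inj/eqP; rewrite eq_le !A1.
    by rewrite subrK.
  by apply: (@projective_affine _ _ 1 0) => // t At; case: A0; exists t.
have [t0|t0] := ltP t 0; first by exists [set t | t < 0]; rewrite ?inE ?eqxx.
have [t1|t1] := ltP 1 t; first by exists [set t | 1 < t]; rewrite ?inE ?eqxx ?orbT.
have [|A As At] := sc t; first by rewrite /= in_itv /= t0.
by exists A; rewrite // !inE As !orbT.
Qed.

Lemma LEJI_PLplus01 : LEJI (PLplus01 R).
Proof.
move=> H fgH; pose act (h : subgroup H) := extend_id (\val (\val h) : homeo I01).
apply: (@elementarily_just_infinite_action R _ act) => //.
- move=> t; have [/I01P[x <-]|It] := pselect (I01 t); first exact: extend_id_val.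
  exact: extend_id_out.
- move=> g h t; have [/I01P[x <-]|It] := pselect (I01 t); first by rewrite /act !extend_id_val.
  by rewrite /act !(extend_id_out _ It).
- by move=> g; have /asboolP[/extend_id_mono] := valP (\val g).
- by move=> g; have /asboolP[] := valP (\val g); exact: extend_id_projective.
- move=> g gE; do 2 apply/val_inj; apply: homeoP => x; apply: val_inj.
  by rewrite -extend_id_val; exact: gE.
Qed.

End Applications.

Theorem theorem0p1 (R : realType) : LEJI (PLplus01 R) /\ LEJI (MonodH R).
Proof. by split; [exact: LEJI_PLplus01|exact: LEJI_MonodH]. Qed.
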